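(* Let $k\ge 2$ be an integer. The simple vertex operator algebra $K_0$ is generated by (the images in $L(k,0)$ of) $\omega$ and $W^3$. In particular, $K_0$ coincides with its subalgebra generated by the images of $\omega, W^3, W^4, W^5$.
   Context: Let $\{h,e,f\}$ be the standard basis of $sl_2$ ($[h,e]=2e$, $[h,f]=-2f$, $[e,f]=h$), with normalized form $\langle h,h\rangle=2$, $\langle e,f\rangle=1$, other pairings zero. $a(n)$ denotes the action of $a\otimes t^n\in\widehat{sl}_2$, with $[a(m),b(n)]=[a,b](m+n)+m\langle a,b\rangle\delta_{m+n,0}k$. $V(k,0)$ is the level $k$ induced (Weyl) module of $\widehat{sl}_2$ generated by $\mathbb{1}$ with $a(n)\mathbb{1}=0$ for $n\ge0$; it is a vertex operator algebra with $Y(a(-1)\mathbb{1},z)=\sum_n a(n)z^{-n-1}$. $\mathcal{J}$ denotes the unique maximal ideal of $V(k,0)$ (generated by $e(-1)^{k+1}\mathbb{1}$) and $L(k,0)=V(k,0)/\mathcal{J}$ is the simple affine vertex operator algebra. $K_0=\{v\in L(k,0)\mid h(m)v=0\text{ for all } m\ge0\}$ is the commutant in $L(k,0)$ of the Heisenberg vertex subalgebra generated by $h(-1)\mathbb{1}$; it is a simple vertex operator algebra. Define $\omega=\frac{1}{2k(k+2)}\big(-kh(-2)\mathbb{1}-h(-1)^2\mathbb{1}+2k\,e(-1)f(-1)\mathbb{1}\big)$ (Virasoro vector of $K_0$) and $W^3=k^2h(-3)\mathbb{1}+3kh(-2)h(-1)\mathbb{1}+2h(-1)^3\mathbb{1}-6k\,h(-1)e(-1)f(-1)\mathbb{1}+3k^2e(-2)f(-1)\mathbb{1}-3k^2e(-1)f(-2)\mathbb{1}$,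 and use the same symbols for their images in $L(k,0)$. $W^4,W^5$ denote the (up to scalar unique) Virasoro primary vectors of weights $4,5$ in $N_0=\{v\in V(k,0)\mid h(m)v=0,\ m\ge0\}$, or their images. ''Generated'' means the smallest vertex subalgebra containing the given vectors. *)

(* Defs.v *)
From HB Require Import structures.
From mathcomp Require Import all_boot all_order all_algebra.
Set Implicit Arguments. Unset Strict Implicit. Unset Printing Implicit Defensive.
Import Order.TTheory GRing.Theory Num.Theory.
Local Open Scope ring_scope.

Section VertexAlgebra.
Variable F : fieldType.
Variable V : lmodType F.
(* Y u n v  is the mode  u_n v  (coefficient of z^{-n-1} in Y(u,z)v) *)
Variable Y : V -> int -> V -> V.
Variable vac : V.

Definition binz (p : int) (i : nat) : F :=
  (\prod_(j < i) ((p - j%:Z)%:~R : F)) / (i`!)%:R.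
Definition sgnz (r : int) : F := if odd `|r|%N then -1 else 1.

Definition va_linear :=
  (forall (a : F) u v n w, Y (a *: u + v) n w = a *: Y u n w + Y v n w) /\
  (forall u n (a : F) w w', Y u n (a *: w + w') = a *: Y u n w + Y u n w').
Definition va_truncation :=
  forall u v, exists N : int, forall n : int, N <= n -> Y u n v = 0.
Definition va_vacuum :=
  (forall v (n : int), Y vac n v = if n == -1 then v else 0) /\
  (forall u, Y u (-1) vac = u) /\
  (forall u (n : int), 0 <= n -> Y u n vac = 0).
(* Borcherds (Jacobi) identity in mode form; all sums are finite because of
   truncation, expressed as: the truncated sums agree from some point on. *)
Definition va_borcherds :=
  forall u v w (p q r : int), exists N : nat, forall M : nat, (N <= M)%N ->
    \sum_(i < M) binz p i *: Y (Y u (r + i%:Z) v) (p + q - i%:Z) w =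
    \sum_(i < M) ((-1) ^+ i * binz r i) *:
        (Y u (p + r - i%:Z) (Y v (q + i%:Z) w)
         - sgnz r *: Y v (q + r - i%:Z) (Y u (p + i%:Z) w)).
Definition vertex_algebra :=
  [/\ va_linear, va_truncation, va_vacuum & va_borcherds].

Definition subspace (T : V -> Prop) :=
  T 0 /\ (forall (a : F) u v, T u -> T v -> T (a *: u + v)).
Definition ideal (T : V -> Prop) :=
  subspace T /\ (forall u v n, T v -> T (Y u n v) /\ T (Y v n u)).
Definition proper_ideal (T : V -> Prop) := ideal T /\ ~ T vac.
Definition maximal_ideal (J : V -> Prop) :=
  proper_ideal J /\
  (forall I, proper_ideal I -> (forall v, J v -> I v) -> forall v, I v -> J v).

(* Vertex subalgebras of the quotient V/J correspond (by taking preimages)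
   to subspaces T of V containing J, the vacuum, and closed under all modes. *)
Definition subalgebra_mod (J T : V -> Prop) :=
  [/\ subspace T, T vac, (forall v, J v -> T v)
    & (forall u v n, T u -> T v -> T (Y u n v))].
(* preimage in V of the vertex subalgebra of V/J generated by the images of S *)
Definition generated_mod (J : V -> Prop) (S : seq V) (v : V) :=
  forall T, subalgebra_mod J T -> (forall s, s \in S -> T s) -> T v.

Definition ih : 'I_3 := @Ordinal 3 0 isT.
Definition ie : 'I_3 := @Ordinal 3 1 isT.
Definition iF : 'I_3 := @Ordinal 3 2 isT.

(* br a b c = coefficient of c in [a,b] *)
Definition br (a b c : 'I_3) : F :=
  match nat_of_ord a, nat_of_ord b, nat_of_ord c with
  | 0%N, 1%N, 1%N => 2 | 1%N, 0%N, 1%N => -2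
  | 0%N, 2%N, 2%N => -2 | 2%N, 0%N, 2%N => 2
  | 1%N, 2%N, 0%N => 1 | 2%N, 1%N, 0%N => -1
  | _, _, _ => 0 end.
Definition form (a b : 'I_3) : F :=
  match nat_of_ord a, nat_of_ord b with
  | 0%N, 0%N => 2 | 1%N, 2%N => 1 | 2%N, 1%N => 1 | _, _ => 0 end.

Variable x : 'I_3 -> V.   (* x a plays the role of a(-1)1 *)
Definition amode (a : 'I_3) (n : int) : V -> V := Y (x a) n.

Definition affine_relations (k : F) :=
  forall a b (m n : int) w,
    amode a m (amode b n w) - amode b n (amode a m w) =
    \sum_(c : 'I_3) br a b c *: amode c (m + n) w
    + (if m + n == 0 then m%:~R * form a b * k else 0) *: w.

(* PBW monomials: (a, n) stands for a(-n-1); sorted lists give the basis *)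
Definition pbw_key (p : 'I_3 * nat) : nat := (3 * p.2 + p.1)%N.
Definition pbw_sorted (s : seq ('I_3 * nat)) : bool :=
  sorted (fun p q => pbw_key p <= pbw_key q)%N s.
Definition pbw_mono (s : seq ('I_3 * nat)) : V :=
  foldr (fun p w => amode p.1 (- (p.2.+1)%:Z) w) vac s.
(* V is the induced (Weyl) module: PBW monomials applied to 1 form a basis *)
Definition pbw_basis :=
  (forall v : V, exists (ss : seq (seq ('I_3 * nat))) (c : seq F),
      all pbw_sorted ss /\ v = \sum_(i < size ss) c`_i *: pbw_mono (nth [::] ss i)) /\
  (forall (ss : seq (seq ('I_3 * nat))) (c : seq F),
      uniq ss -> all pbw_sorted ss -> size c = size ss ->
      \sum_(i < size ss) c`_i *: pbw_mono (nth [::] ss i) = 0 -> forall i, c`_i = 0).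

Definition omega_vec (k : F) : V :=
  (2 * k * (k + 2))^-1 *:
   (- (k *: amode ih (-2) vac) - amode ih (-1) (amode ih (-1) vac)
    + (2 * k) *: amode ie (-1) (amode iF (-1) vac)).
Definition W3_vec (k : F) : V :=
  k ^+ 2 *: amode ih (-3) vac
  + (3 * k) *: amode ih (-2) (amode ih (-1) vac)
  + 2 *: amode ih (-1) (amode ih (-1) (amode ih (-1) vac))
  - (6 * k) *: amode ih (-1) (amode ie (-1) (amode iF (-1) vac))
  + (3 * k ^+ 2) *: amode ie (-2) (amode iF (-1) vac)
  - (3 * k ^+ 2) *: amode ie (-1) (amode iF (-2) vac).

(* preimage in V of K_0 = {v in V/J | h(m) v = 0, m >= 0} *)
Definition K0_pre (J : V -> Prop) (v : V) :=
  forall m : int, 0 <= m -> J (amode ih m v).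
Definition N0 (v : V) := forall m : int, 0 <= m -> amode ih m v = 0.
(* nonzero Virasoro primary vector of weight d in N_0, for L(n) = om_{n+1} *)
Definition vir_primary_N0 (om : V) (d : nat) (w : V) :=
  [/\ N0 w, w != 0, Y om 1 w = d%:R *: w
    & forall n : int, 0 < n -> Y om (n + 1) w = 0].
End VertexAlgebra.

(* Main.v *)
(* Call u_m the vector e(-m-1)f(-1)1.  Let T be a subspace containing J such
   that T/J is a subalgebra of K_0 containing omega and W^3, and let B be the
   span of the vectors h(-l_1)...h(-l_r)t with t in T.  Since h(m)T lies in J
   for m >= 0, the space B is closed under all modes.  It contains u_0 (from
   omega) and u_1 (from W^3 and the derivative of u_0), and inductively all
   u_m: modulo products of h with smaller u_j,
     (u_1)_1 u_m = (m+3)(k(m+1)+m+2) u_{m+1},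
   a nonzero multiple.  The modes (u_a)_{-b} have leading term e(-a-1)f(-b),
   so induction on the length of PBW monomials shows that B contains all
   vectors of h(0)-weight zero.  Finally h(0) and the sum of the h(-s)h(s) act
   semisimply modulo J, which puts K_0 first in B and then in T. *)
Require Import Defs.
From HB Require Import structures.
From mathcomp Require Import all_boot all_order all_algebra.
From mathcomp Require Import zify ring.
Import Order.TTheory GRing.Theory Num.Theory.
Local Open Scope ring_scope.

Set Implicit Arguments.
Unset Strict Implicit.
Unset Printing Implicit Defensive.

(** * Linear identities in a module, decided by comparing coefficients *)

Section ModuleReflection.
Variables (F : fieldType) (V : lmodType F).

Inductive mexpr :=
| MVar of nat | MZero | MAdd of mexpr & mexpr | MOpp of mexpr | MScale of F & mexpr.

Fixpoint meval (env : seq V) (e : mexpr) : V :=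
  match e with
  | MVar i => env`_i
  | MZero => 0
  | MAdd e1 e2 => meval env e1 + meval env e2
  | MOpp e1 => - meval env e1
  | MScale c e1 => c *: meval env e1
  end.

(** The index test is [eqn] rather than [==] so that [cbn] evaluates it on concrete numbers. *)
Fixpoint mcoef (e : mexpr) (i : nat) : F :=
  match e with
  | MVar j => if eqn i j then 1 else 0
  | MZero => 0
  | MAdd e1 e2 => mcoef e1 i + mcoef e2 i
  | MOpp e1 => - mcoef e1 i
  | MScale c e1 => c * mcoef e1 i
  end.

Fixpoint mcoef_eq (n : nat) (e1 e2 : mexpr) : Prop :=
  if n is n'.+1 then mcoef e1 n' = mcoef e2 n' /\ mcoef_eq n' e1 e2 else True.

Lemma meval_sum env e : meval env e = \sum_(i < size env) mcoef e i *: env`_i.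
Proof.
elim: e => [j||e1 IH1 e2 IH2|e1 IH1|c e1 IH1] /=.
- have coefE (i : nat) : (if eqn i j then 1 else 0 : F) = (i == j)%:R.
    by rewrite eqnE; case: eqP.
  have [ltj|gej] := ltnP j (size env); last first.
    rewrite nth_default// big1// => i _; rewrite coefE.
    by rewrite ltn_eqF ?scale0r// (leq_trans (ltn_ord i)).
  rewrite (bigD1 (Ordinal ltj))//= coefE eqxx scale1r big1 ?addr0// => i ij.
  by rewrite coefE (_ : (i == j :> nat) = false) ?scale0r//; apply: contraNF ij.
- by rewrite big1// => i _; rewrite scale0r.
- by rewrite IH1 IH2 -big_split/=; apply: eq_bigr => i _; rewrite scalerDl.
- by rewrite IH1 -sumrN; apply: eq_bigr => i _; rewrite scaleNr.
- by rewrite IH1 scaler_sumr; apply: eq_bigr => i _; rewrite scalerA.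
Qed.

Lemma meval_eq env e1 e2 :
  mcoef_eq (size env) e1 e2 -> meval env e1 = meval env e2.
Proof.
rewrite !meval_sum; elim: (size env) => [|n IH]; first by rewrite !big_ord0.
by case=> En /IH E; rewrite !big_ord_recr/= E En.
Qed.

End ModuleReflection.

Ltac atom_mem t l :=
  match l with
  | @nil _ => false
  | cons ?a ?l' =>
    match l' with
    | _ => let _ := match goal with |- _ => unify a t end in true
    | _ => atom_mem t l'
    end
  end.
Ltac atom_index t l :=
  match l with
  | cons ?a ?l' =>
    match l' with
    | _ => let _ := match goal with |- _ => unify a t end in constr:(O)
    | _ => let n := atom_index t l' in constr:(S n)
    end
  end.
Ltac atoms_of t l :=
  match t with
  | GRing.add ?a ?b => let l1 := atoms_of b l in atoms_of a l1
  | GRing.opp ?a => atoms_of a l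
  | GRing.scale _ ?a => atoms_of a l
  | GRing.zero => l
  | _ => match atom_mem t l with true => l | false => constr:(cons t l) end
  end.
Ltac reify_module F t l :=
  match t with
  | GRing.add ?a ?b =>
    let ra := reify_module F a l in let rb := reify_module F b l in
    constr:(@MAdd F ra rb)
  | GRing.opp ?a => let ra := reify_module F a l in constr:(@MOpp F ra)
  | GRing.scale ?c ?a => let ra := reify_module F a l in constr:(@MScale F c ra)
  | GRing.zero => constr:(@MZero F)
  | _ => let n := atom_index t l in constr:(@MVar F n)
  end.
(* Vectors that are not linear combinations are treated as atoms, identified up
   to conversion; [ring] then compares the coefficients of each atom. *)
Ltac module_eq F :=
  match goal with |- @eq ?V ?a ?b =>
    let l0 := atoms_of a (@nil V) in
    let l := atoms_of b l0 in
    let ra := reify_module F a l in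
    let rb := reify_module F b l in
    apply: (@meval_eq F _ l ra rb);
    cbn [mcoef_eq mcoef size eqn]; repeat split; try ring
  end.

(** * Subspaces and linear spans *)

Section Subspaces.
Variables (F : fieldType) (V : lmodType F) (P : V -> Prop).
Hypothesis subP : subspace P.

Lemma subspace0 : P 0. Proof. by case: subP. Qed.

Lemma subspaceZD a u v : P u -> P v -> P (a *: u + v).
Proof. by case: subP => _; apply. Qed.

Lemma subspaceZ a u : P u -> P (a *: u).
Proof. by move=> Pu; rewrite -[_ *: _]addr0; apply: subspaceZD Pu subspace0. Qed.

Lemma subspaceD u v : P u -> P v -> P (u + v).
Proof. by move=> Pu; rewrite -[u]scale1r; apply: subspaceZD. Qed.

Lemma subspaceN u : P u -> P (- u).
Proof. by rewrite -scaleN1r; apply: subspaceZ. Qed.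

Lemma subspaceB u v : P u -> P v -> P (u - v).
Proof. by move=> Pu /subspaceN; apply: subspaceD. Qed.

Lemma subspace_addl u v : P u -> P (u + v) -> P v.
Proof.
by move=> Pu Puv; rewrite -[v](addKr u); apply: subspaceD Puv; apply: subspaceN.
Qed.

Lemma subspace_addr u v : P (u + v) -> P u -> P v.
Proof. by move=> Puv Pu; apply: subspace_addl Pu Puv. Qed.

Lemma subspace_congr u v : P (u - v) -> P v -> P u.
Proof. by move=> Puv Pv; rewrite -(subrK v u); apply: subspaceD. Qed.

Lemma subspaceZ_inv a u : a != 0 -> P (a *: u) -> P u.
Proof. by move=> a0 /(subspaceZ a^-1); rewrite scalerA mulVf// scale1r. Qed.

Lemma subspace_sum n (f : 'I_n -> V) : (forall i, P (f i)) -> P (\sum_i f i).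
Proof.
by move=> Pf; elim/big_rec: _ => [|i u _ Pu]; [apply: subspace0 | apply: subspaceD].
Qed.

End Subspaces.

Section Span.
Variables (F : fieldType) (V : lmodType F).
Implicit Type S : V -> Prop.

Inductive linspan S : V -> Prop :=
| linspan0 : linspan S 0
| linspan_cons a u v : S u -> linspan S v -> linspan S (a *: u + v).

Lemma linspan_gen S u : S u -> linspan S u.
Proof.
by move=> Su; rewrite -[u]addr0 -[u]scale1r; apply: linspan_cons => //; apply: linspan0.
Qed.

Lemma linspan_subspace S : subspace (linspan S).
Proof.
split=> [|a u v Su Sv]; first exact: linspan0.
elim: Su => [|b u1 u2 Su1 _ IH]; first by rewrite scaler0 add0r.
by rewrite scalerDr scalerA -addrA; apply: linspan_cons.
Qed.

Lemma linspan_min S P : subspace P -> (forall u, S u -> P u) ->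
  forall v, linspan S v -> P v.
Proof.
move=> sP SP v; elim=> [|a u w Su _ Pw]; first exact: subspace0.
by apply: subspaceZD => //; apply: SP.
Qed.

Lemma subspace_preim (f : V -> V) P : linear f -> subspace P ->
  subspace (fun v => P (f v)).
Proof.
move=> lf sP; split=> [|a u v Pu Pv]; last by rewrite lf; apply: subspaceZD.
have -> : f 0 = 0; last exact: subspace0.
by have := lf (-1) 0 0; rewrite scaler0 addr0 scaleN1r addNr.
Qed.

End Span.

(** * Semisimple operators modulo a stable subspace *)

(* A linear operator [A] preserving [J] acts semisimply modulo [J] on the
   vectors [v = w + (eigenvectors of nonzero eigenvalue)] with [A w] in [J];
   then [A v] in [J] forces [v] to equal [w] modulo [J]. *)
Section Eigenvectors.
Variables (F : fieldType) (V : lmodType F) (A : V -> V) (J : V -> Prop).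
Hypothesis linA : linear A.
Hypothesis subJ : subspace J.
Hypothesis stabJ : forall v, J v -> J (A v).

Inductive eigen_sum : nat -> V -> Prop :=
| eigen_sum0 v : J v -> eigen_sum 0 v
| eigen_sumS n a u v : a != 0 -> J (A u - a *: u) -> eigen_sum n v ->
    eigen_sum n.+1 (u + v).

Let linAB u v : A (u - v) = A u - A v.
Proof. by rewrite addrC -scaleN1r linA scaleN1r addrC. Qed.

Let linAD u v : A (u + v) = A u + A v.
Proof. by rewrite -{1}[u]scale1r linA scale1r. Qed.

Let linAZ a u : A (a *: u) = a *: A u.
Proof.
have A0 : A 0 = 0 by have := linAB 0 0; rewrite !subr0 subrr.
by rewrite -[a *: u]addr0 linA A0 addr0.
Qed.

(** [A] commutes with [A - b], so each summand stays an eigenvector modulo [J] for the same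
    eigenvalue. *)
Lemma eigen_sum_shift b n v : eigen_sum n v -> eigen_sum n (A v - b *: v).
Proof.
elim=> [w Jw|{}n a u {}v a0 Ju _ IH].
  by apply: eigen_sum0; apply: subspaceB (stabJ _) (subspaceZ _ _ _).
rewrite linAD scalerDr opprD addrACA; apply: eigen_sumS a0 _ IH.
have -> : A (A u - b *: u) - a *: (A u - b *: u)
  = A (A u - a *: u) - b *: (A u - a *: u).
  by rewrite !linAB !linAZ; module_eq F.
by apply: subspaceB (stabJ _) (subspaceZ _ _ _).
Qed.

(** Induction on the number of summands: [A - a] kills the first one modulo [J], so the shifted
    vector has one summand fewer and is still annihilated by [A] modulo [J]. Then [A v] and
    [A v - a *: v] both lie in [J], and [a] is nonzero. Eigenvalues may repeat. *)
Lemma eigen_sum_ker n v : eigen_sum n v -> J (A v) -> J v.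
Proof.
elim: n v => [|n IH] v; first by move=> H; inversion H.
move=> H; inversion_clear H as [|? a u w a0 Ju Sw]; set v0 := u + w => JAv.
have Jd : J (A v0 - a *: v0).
  have -> : A v0 - a *: v0 = (A u - a *: u) + (A w - a *: w).
    by rewrite linAD scalerDr opprD addrACA.
  apply: subspaceD => //; apply: IH; first exact: eigen_sum_shift.
  have -> : A (A w - a *: w) = A (A v0 - a *: v0) - A (A u - a *: u).
    by rewrite -linAB; congr (A _); rewrite /v0 linAD; module_eq F.
  apply: subspaceB => //; last exact: stabJ.
  by rewrite linAB linAZ; apply: subspaceB => //; [apply: stabJ|apply: subspaceZ].
apply: (subspaceZ_inv subJ a0).
by rewrite -(subKr (A v0) (a *: v0)); apply: subspaceB.
Qed.

Definition eigen_split (G : V -> Prop) v :=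
  exists w n u, [/\ G w, eigen_sum n u & v = w + u].

Lemma eigen_split_subspace G : subspace G -> subspace (eigen_split G).
Proof.
move=> sG; split=> [|a _ _ [w [n [u [Gw Su ->]]]] [w' [n' [u' [Gw' Su' ->]]]]].
  exists 0, 0%N, 0; split; rewrite ?addr0//; first by case: sG.
  by apply: eigen_sum0; apply: subspace0.
suff [m Sm] : exists m, eigen_sum m (a *: u + u').
  exists (a *: w + w'), m, (a *: u + u'); split=> //; first exact: subspaceZD.
  by module_eq F.
elim: Su => [v Jv|{}n b u1 u2 b0 Ju1 _ [m Sm]].
  exists n'; elim: Su' => [v' Jv'|{}n' b u1 u2 b0 Ju1 _ IH].
    by apply: eigen_sum0; apply: subspaceZD.
  rewrite addrCA; exact: eigen_sumS b0 Ju1 IH.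
exists m.+1; rewrite scalerDr -addrA; apply: eigen_sumS b0 _ Sm.
by rewrite linAZ scalerA mulrC -scalerA -scalerBr; apply: subspaceZ.
Qed.

Lemma eigen_split_ker G v : (forall w, G w -> J (A w)) ->
  eigen_split G v -> J (A v) -> exists2 w, G w & J (v - w).
Proof.
move=> GA [w [n [u [Gw Su ->]]]]; rewrite linAD => JA; exists w => //.
rewrite addrC addKr; apply: eigen_sum_ker Su _.
by apply: (subspace_addl subJ) JA; apply: GA.
Qed.

End Eigenvectors.

(** * Commutators and iterated modes from the Borcherds identity *)

Section Borcherds.
Variables (F : numFieldType) (V : lmodType F) (Y : V -> int -> V -> V) (vac : V).
Hypothesis VA : vertex_algebra Y vac.

Let linY : va_linear Y. Proof. by case: VA. Qed.
Let vacY : va_vacuum Y vac. Proof. by case: VA. Qed.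
Let borY : va_borcherds Y. Proof. by case: VA. Qed.

Lemma mode_linear u n : linear (Y u n).
Proof. by move=> a v w; case: linY => _; apply. Qed.
Lemma state_linear n w : linear (fun u => Y u n w).
Proof. by move=> a u v; case: linY => + _; apply. Qed.

Lemma mode0 u n : Y u n 0 = 0.
Proof. by have := mode_linear u n (-1) 0 0; rewrite scaler0 addr0 scaleN1r addNr. Qed.
Lemma modeZ u n a v : Y u n (a *: v) = a *: Y u n v.
Proof. by rewrite -[a *: v]addr0 mode_linear mode0 addr0. Qed.
Lemma modeD u n v w : Y u n (v + w) = Y u n v + Y u n w.
Proof. by rewrite -{1}[v]scale1r mode_linear scale1r. Qed.
Lemma modeN u n v : Y u n (- v) = - Y u n v.
Proof. by rewrite -!scaleN1r modeZ. Qed.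

Lemma vac_state u : Y u (-1) vac = u.
Proof. by case: vacY => _ []. Qed.
Lemma vac_annihil u n : 0 <= n -> Y u n vac = 0.
Proof. by case: vacY => _ [] _; apply. Qed.

Lemma binz_0 p : binz F p 0 = 1.
Proof. by rewrite /binz big_ord0 fact0 divr1. Qed.
Lemma binz_0S i : binz F 0 i.+1 = 0.
Proof. by rewrite /binz big_ord_recl /= subr0 mul0r mul0r. Qed.
Lemma sgnz_0 : sgnz F 0 = 1. Proof. by []. Qed.

(** At [r = 0] the binomials on the right of the Borcherds identity vanish except at index 0. *)
Lemma commutator_modes u v p q w : exists N, forall M, (N <= M)%N ->
  Y u p (Y v q w) - Y v q (Y u p w)
  = \sum_(i < M) binz F p i *: Y (Y u i%:Z v) (p + q - i%:Z) w.
Proof.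
(* The bound is [N.+1] so that the sum is nonempty and its term of index 0 can be split off. *)
have [N HN] := borY u v w p q 0; exists N.+1 => M leM.
transitivity (\sum_(i < M) binz F p i *: Y (Y u (0 + i%:Z) v) (p + q - i%:Z) w);
  last by apply: eq_bigr => i _; rewrite add0r.
rewrite HN ?(ltnW leM)//; case: M leM => // M _.
rewrite big_ord_recl /= binz_0 mulr1 expr0 scale1r sgnz_0 scale1r.
rewrite big1 ?addr0 ?subr0// => i _.
by rewrite /bump /= add1n binz_0S mulr0 scale0r.
Qed.

(** At [p = 0] it is the left side of the Borcherds identity that reduces to its term of index 0. *)
Lemma mode_product u v r q w : exists N, forall M, (N <= M)%N ->
  Y (Y u r v) q w = \sum_(i < M) ((-1) ^+ i * binz F r i) *:
    (Y u (r - i%:Z) (Y v (q + i%:Z) w)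
     - sgnz F r *: Y v (q + r - i%:Z) (Y u i%:Z w)).
Proof.
have [N HN] := borY u v w 0 q r; exists N.+1 => M leM.
transitivity (\sum_(i < M) ((-1) ^+ i * binz F r i) *:
    (Y u (0 + r - i%:Z) (Y v (q + i%:Z) w)
     - sgnz F r *: Y v (q + r - i%:Z) (Y u (0 + i%:Z) w)));
  last by apply: eq_bigr => i _; rewrite !add0r.
rewrite -HN ?(ltnW leM)//; case: M leM => // M _.
rewrite big_ord_recl /= binz_0 scale1r big1; first by rewrite addr0 add0r subr0 addr0.
by move=> i _; rewrite /bump /= add1n binz_0S scale0r.
Qed.

Variable P : V -> Prop.
Hypothesis subP : subspace P.

Lemma subspace_commutator u v p q w :
  (forall i : nat, P (Y (Y u i v) (p + q - i%:Z) w)) ->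
  P (Y u p (Y v q w) - Y v q (Y u p w)).
Proof.
move=> Pi; have [N HN] := commutator_modes u v p q w; rewrite (HN N)//.
by apply: subspace_sum => // i; apply: subspaceZ.
Qed.

Lemma subspace_product u v r q w :
  (forall i : nat, P (Y u (r - i%:Z) (Y v (q + i%:Z) w))) ->
  (forall i : nat, P (Y v (q + r - i%:Z) (Y u i w))) ->
  P (Y (Y u r v) q w).
Proof.
move=> P1 P2; have [N HN] := mode_product u v r q w; rewrite (HN N)//.
by apply: subspace_sum => // i; apply: subspaceZ => //; apply: subspaceB => //; apply: subspaceZ.
Qed.

End Borcherds.

(** * Affine commutation relations; [omega] and [W^3] lie in [N_0] *)

Section Affine.
Variables (F : numFieldType) (V : lmodType F).
Variables (Y : V -> int -> V -> V) (vac : V) (x : 'I_3 -> V) (k : F).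
Hypothesis VA : vertex_algebra Y vac.
Hypothesis AR : affine_relations Y x k.

Notation h := (amode Y x ih).
Notation e := (amode Y x ie).
Notation f := (amode Y x iF).

Lemma amode_linear a n : linear (amode Y x a n).
Proof. exact: mode_linear VA _ _. Qed.
Lemma amode0 a n : amode Y x a n 0 = 0.
Proof. exact: mode0 VA _ _. Qed.
Lemma amodeZ a n b v : amode Y x a n (b *: v) = b *: amode Y x a n v.
Proof. exact: modeZ VA _ _ _ _. Qed.
Lemma amodeD a n u v : amode Y x a n (u + v) = amode Y x a n u + amode Y x a n v.
Proof. exact: modeD VA _ _ _ _. Qed.
Lemma amodeN a n v : amode Y x a n (- v) = - amode Y x a n v.
Proof. exact: modeN VA _ _ _. Qed.
Lemma amodeB a n u v : amode Y x a n (u - v) = amode Y x a n u - amode Y x a n v.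
Proof. by rewrite amodeD amodeN. Qed.
Definition amodeE := (amodeD, amodeZ, amodeN).

Lemma amode_vac a n : 0 <= n -> amode Y x a n vac = 0.
Proof. exact: vac_annihil VA _ _. Qed.

Lemma amode_vac_nat a (n : nat) : amode Y x a n vac = 0.
Proof. exact: amode_vac. Qed.

Lemma sum_ord3 (g : 'I_3 -> V) : \sum_c g c = g ih + g ie + g iF.
Proof.
rewrite !big_ord_recl big_ord0 addr0 addrA.
by congr (g _ + g _ + g _); apply: val_inj.
Qed.

Lemma amode_swap a b m n w : amode Y x a m (amode Y x b n w) =
  amode Y x b n (amode Y x a m w) +
  (br F a b ih *: h (m + n) w + br F a b ie *: e (m + n) w + br F a b iF *: f (m + n) w
   + (if m + n == 0 then m%:~R * Defs.form F a b * k else 0) *: w).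
Proof. by have := AR a b m n w; rewrite sum_ord3 => <-; rewrite addrCA subrr addr0. Qed.

Lemma h_h m n w :
  h m (h n w) = h n (h m w) + (if m + n == 0 then m%:~R * 2 * k else 0) *: w.
Proof. by rewrite amode_swap /br /Defs.form /=; case: ifP => _; module_eq F. Qed.
Lemma h_e m n w : h m (e n w) = e n (h m w) + 2 *: e (m + n) w.
Proof. by rewrite amode_swap /br /Defs.form /=; case: ifP => _; module_eq F. Qed.
Lemma h_f m n w : h m (f n w) = f n (h m w) - 2 *: f (m + n) w.
Proof. by rewrite amode_swap /br /Defs.form /=; case: ifP => _; module_eq F. Qed.
Lemma e_h m n w : e m (h n w) = h n (e m w) - 2 *: e (m + n) w.
Proof. by rewrite amode_swap /br /Defs.form /=; case: ifP => _; module_eq F. Qed.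
Lemma f_h m n w : f m (h n w) = h n (f m w) + 2 *: f (m + n) w.
Proof. by rewrite amode_swap /br /Defs.form /=; case: ifP => _; module_eq F. Qed.
Lemma e_e m n w : e m (e n w) = e n (e m w).
Proof. by rewrite amode_swap /br /Defs.form /=; case: ifP => _; module_eq F. Qed.
Lemma f_f m n w : f m (f n w) = f n (f m w).
Proof. by rewrite amode_swap /br /Defs.form /=; case: ifP => _; module_eq F. Qed.
Lemma e_f m n w : e m (f n w) =
  f n (e m w) + h (m + n) w + (if m + n == 0 then m%:~R * k else 0) *: w.
Proof. by rewrite amode_swap /br /Defs.form /=; case: ifP => _; module_eq F. Qed.
Lemma f_e m n w : f m (e n w) =
  e n (f m w) - h (m + n) w + (if m + n == 0 then m%:~R * k else 0) *: w.
Proof. by rewrite amode_swap /br /Defs.form /=; case: ifP => _; module_eq F. Qed.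

(** With annihilation indices written as [Posz] and creation indices as [Negz], these rules reduce a
    sum of two such indices to a single constructor once the cases are concrete. *)
Lemma addSS m n : Posz m.+1 + Negz n.+1 = Posz m + Negz n.
Proof. by rewrite !NegzE; lia. Qed.
Lemma addS0 m : Posz m.+1 + Negz 0 = Posz m.
Proof. by rewrite NegzE; lia. Qed.
Lemma add0N n : Posz 0 + Negz n = Negz n.
Proof. by rewrite add0r. Qed.
Definition addPN := (addSS, addS0, add0N).

Lemma h_h_nat (m n : nat) w : h m (h (Negz n) w) =
  h (Negz n) (h m w) + (if m == n.+1 then m%:R * 2 * k else 0) *: w.
Proof. by rewrite h_h NegzE subr_eq0 eqz_nat; case: ifP. Qed.

Lemma h_e_nat (m : nat) n w : h m (e n w) = e n (h m w) + 2 *: e (Posz m + n) w.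
Proof. exact: h_e. Qed.

Lemma h_f_nat (m : nat) n w : h m (f n w) = f n (h m w) - 2 *: f (Posz m + n) w.
Proof. exact: h_f. Qed.

Lemma e_f_vac (m n : nat) : e m (f (Negz n) vac) =
  h (Posz m + Negz n) vac + (if m == n.+1 then m%:R * k else 0) *: vac.
Proof.
by rewrite e_f amode_vac// amode0 add0r NegzE subr_eq0 eqz_nat; case: ifP.
Qed.

Lemma h_omega m : 0 <= m -> h m (omega_vec Y vac x k) = 0.
Proof.
rewrite /omega_vec -[(-1)%R]/(Negz 0) -[(-2)%R]/(Negz 1) !amodeE => m0.
apply/eqP; rewrite scaler_eq0; apply/orP; right; apply/eqP.
(* Central terms can occur only for [m] up to the weight 2; all larger modes form one case. *)
case: m m0 => [[|[|[|m]]]|//] _;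
 rewrite !(h_h_nat, h_e_nat, h_f_nat, e_f_vac, amode_vac_nat, amodeE, amode0, addPN)//=;
 module_eq F.
Qed.

Lemma h_W3 m : 0 <= m -> h m (W3_vec Y vac x k) = 0.
Proof.
rewrite /W3_vec -[(-1)%R]/(Negz 0) -[(-2)%R]/(Negz 1) -[(-3)%R]/(Negz 2).
case: m => [[|[|[|[|m]]]]|//] _;
 rewrite !amodeE !(h_h_nat, h_e_nat, h_f_nat, e_f_vac, amode_vac_nat, amodeE, amode0, addPN)/=;
 module_eq F.
Qed.

End Affine.

(** * Filtration by length of PBW monomials, graded by charge *)

Section Filtration.
Variables (F : numFieldType) (V : lmodType F).
Variables (Y : V -> int -> V -> V) (vac : V) (x : 'I_3 -> V) (k : F).
Hypothesis VA : vertex_algebra Y vac.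
Hypothesis AR : affine_relations Y x k.

Notation h := (amode Y x ih).
Notation e := (amode Y x ie).
Notation f := (amode Y x iF).
Notation mono := (pbw_mono Y vac x).

(** Half the eigenvalue of the adjoint action of h. *)
Definition weight (a : 'I_3) : int :=
  match nat_of_ord a with 0%N => 0 | 1%N => 1 | _ => -1 end.

Definition charge (s : seq ('I_3 * nat)) : int := \sum_(p <- s) weight p.1.

Lemma charge_cons p s : charge (p :: s) = weight p.1 + charge s.
Proof. by rewrite /charge big_cons. Qed.

Lemma charge_cat s1 s2 : charge (s1 ++ s2) = charge s1 + charge s2.
Proof. by rewrite /charge big_cat. Qed.

Lemma ord3P (a : 'I_3) : [\/ a = ih, a = ie | a = iF].
Proof.
by case: a => [[|[|[|//]]] ?]; [apply: Or31|apply: Or32|apply: Or33]; apply: val_inj.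
Qed.

Lemma br_weight a b c : weight c != weight a + weight b -> br F a b c = 0.
Proof.
by case: (ord3P a) => ->; case: (ord3P b) => ->; case: (ord3P c) => ->.
Qed.

Lemma form_weight a b : weight a + weight b != 0 -> Defs.form F a b = 0.
Proof. by case: (ord3P a) => ->; case: (ord3P b) => ->. Qed.

(** The bracket respects weights, and the form pairs only opposite weights, so the central term
    appears only in total weight zero. *)
Lemma subspace_amode_commutator P a b m n w : subspace P ->
  (forall c, weight c = weight a + weight b -> P (amode Y x c (m + n) w)) ->
  (weight a + weight b = 0 -> P w) ->
  P (amode Y x a m (amode Y x b n w) - amode Y x b n (amode Y x a m w)).
Proof.
move=> sP Pc Pw; rewrite AR; apply: subspaceD => //.
  apply: subspace_sum => // c; have [Ec|Nc] := eqVneq (weight c) (weight a + weight b).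
    by apply: subspaceZ => //; apply: Pc.
  by rewrite br_weight// scale0r; apply: subspace0.
have [E0|N0] := eqVneq (weight a + weight b) 0; first by apply: subspaceZ => //; apply: Pw.
by rewrite form_weight// mulr0 mul0r if_same scale0r; apply: subspace0.
Qed.

(** The monomials need not be sorted, so prepending any creation mode again gives a monomial. *)
Definition fil (n : nat) (c : int) : V -> Prop :=
  linspan (fun v => exists s, [/\ (size s <= n)%N, charge s = c & v = mono s]).

Lemma fil_subspace n c : subspace (fil n c). Proof. exact: linspan_subspace. Qed.

Lemma fil_mono s : fil (size s) (charge s) (mono s).
Proof. by apply: linspan_gen; exists s. Qed.

Lemma fil_le n n' c v : (n <= n')%N -> fil n c v -> fil n' c v.
Proof.
move=> le; apply: linspan_min (fil_subspace _ _) _ v => _ [s [sz <- ->]].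
by apply: linspan_gen; exists s; split=> //; apply: leq_trans le.
Qed.

Lemma fil_extend n c (g : V -> V) P : subspace P -> linear g ->
  (forall s, (size s <= n)%N -> charge s = c -> P (g (mono s))) ->
  forall v, fil n c v -> P (g v).
Proof.
move=> sP lg H v; apply: (linspan_min (P := fun v => P (g v))).
  exact: subspace_preim.
by move=> _ [s [sz cs ->]]; apply: H.
Qed.

Lemma fil_creation a j n c v :
  fil n c v -> fil n.+1 (weight a + c) (amode Y x a (- j.+1%:Z) v).
Proof.
apply: fil_extend; [exact: fil_subspace|exact: amode_linear x VA _ _|] => s sz <-.
by apply: linspan_gen; exists ((a, j) :: s); rewrite charge_cons.
Qed.

(** An annihilation mode is moved right until it meets the vacuum; each commutator replaces two
    modes by at most one. The mode so produced may have either sign, so both bounds go through one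
    induction. *)
Lemma fil_amode_mono s a m :
  fil (size s).+1 (weight a + charge s) (amode Y x a m (mono s)) /\
  (0 <= m -> fil (size s) (weight a + charge s) (amode Y x a m (mono s))).
Proof.
(* The first bound follows from the second, since a negative mode merely lengthens the monomial by
   one. *)
have W t b n : (0 <= n -> fil (size t) (weight b + charge t) (amode Y x b n (mono t))) ->
    fil (size t).+1 (weight b + charge t) (amode Y x b n (mono t)).
  case: n => n H; first by apply: fil_le (H _).
  by rewrite NegzE; apply: fil_creation (fil_mono t).
elim: s a m => [|[b j] s IH] a m.
  have H : 0 <= m -> fil 0 (weight a + charge [::]) (amode Y x a m (mono [::])).
    by move=> m0; rewrite /= (amode_vac x VA)//; apply: linspan0.
  by split=> //; apply: W.
suff H : 0 <= m -> fil (size s).+1 (weight a + charge ((b, j) :: s))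
    (amode Y x a m (mono ((b, j) :: s))) by split=> //; apply: W.
move=> m0; rewrite charge_cons /= addrA.
apply: (subspace_congr (fil_subspace _ _)).
  apply: subspace_amode_commutator; first exact: fil_subspace.
    by move=> c <-; case: (IH c (m - j.+1%:Z)).
  by move=> ->; rewrite add0r; apply: fil_le (fil_mono s).
rewrite [weight a + _]addrC -addrA; apply: fil_creation.
by case: (IH a m) => _; apply.
Qed.

Lemma fil_amode n c v a m : fil n c v -> fil n.+1 (weight a + c) (amode Y x a m v).
Proof.
apply: fil_extend; [exact: fil_subspace|exact: amode_linear x VA _ _|] => s sz <-.
by case: (fil_amode_mono s a m) => + _; apply: fil_le.
Qed.

Lemma fil_annihilation n c v a m :
  0 <= m -> fil n c v -> fil n (weight a + c) (amode Y x a m v).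
Proof.
move=> m0; apply: fil_extend; [exact: fil_subspace|exact: amode_linear x VA _ _|] => s sz <-.
by case: (fil_amode_mono s a m) => _ /(_ m0); apply: fil_le.
Qed.

Lemma fil_commutator n c v a b p q : fil n c v ->
  fil n.+1 (weight a + weight b + c)
    (amode Y x a p (amode Y x b q v) - amode Y x b q (amode Y x a p v)).
Proof.
move=> Fv; apply: subspace_amode_commutator; first exact: fil_subspace.
  by move=> d <-; apply: fil_amode.
by move=> ->; rewrite add0r; apply: fil_le Fv.
Qed.

(** Each transposition costs a commutator, which is shorter by one factor. *)
Lemma mono_front s1 p s2 :
  fil (size s1 + size s2) (weight p.1 + charge (s1 ++ s2))
    (mono (s1 ++ p :: s2) - mono (p :: s1 ++ s2)).
Proof.
elim: s1 => [|q s1 IH]; first by rewrite subrr; apply: linspan0.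
set t := s1 ++ s2; rewrite /= -/t charge_cons addrCA.
pose A := amode Y x q.1 (- q.2.+1%:Z); pose B := amode Y x p.1 (- p.2.+1%:Z).
have -> : A (mono (s1 ++ p :: s2)) - B (A (mono t)) =
    A (mono (s1 ++ p :: s2) - mono (p :: t)) + (A (B (mono t)) - B (A (mono t))).
  by rewrite /A (amodeB x VA) /= -/A -/B; module_eq F.
apply: (subspaceD (fil_subspace _ _)); first exact: fil_creation IH.
by rewrite addrA addSn -size_cat; apply: fil_commutator (fil_mono t).
Qed.

(** * Charge-zero vectors from the products e(-m-1)f(-1)1 *)

Section ChargeZero.
Variable P : V -> Prop.
Hypothesis subP : subspace P.
Hypothesis closedP : forall u v n, P u -> P v -> P (Y u n v).
Hypothesis P_vac : P vac.
Hypothesis P_h : P (x ih).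
Hypothesis P_ef : forall m : nat, P (e (- m.+1%:Z) (x iF)).

(** In the product formula for the mode [- b.+1] of e(-a-1)f(-1)1 the wanted vector is the term of
    index 0. Every other term has a smaller [b] or contains an annihilation mode, which leaves
    length at most [n.+1]. *)
Lemma P_ef_mode n w : (forall v, fil n.+1 0 v -> P v) -> fil n 0 w -> P w ->
  forall b a : nat, P (e (- a.+1%:Z) (f (- b.+1%:Z) w)).
Proof.
move=> Pn Fw Pw; elim/ltn_ind => b IHb a.
have := closedP (- b.+1%:Z) (P_ef a) Pw.
have [N HN] := mode_product VA (x ie) (x iF) (- a.+1%:Z) (- b.+1%:Z) w.
have Pfe p q : 0 <= q -> P (f p (e q w)).
  by move=> q0; apply: Pn; apply: (@fil_amode n 1 _ iF); apply: (@fil_annihilation n 0 _ ie).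
rewrite (HN N.+1)// big_ord_recl /= (binz_0 F) mulr1 expr0 scale1r subr0 addr0 addrC.
move=> H0; apply: (subspace_congr subP (subspace_addl subP _ H0)).
  apply: subspace_sum => // i; apply: subspaceZ => //.
  rewrite /bump /= add1n; apply: subspaceB => //; last by apply: subspaceZ => //; apply: Pfe.
  (* Up to index [b] the mode of f is still a creation mode, with a smaller index; beyond that it
     annihilates. *)
  have [le|lt] := leqP i.+1 b.
    have -> : - a.+1%:Z - i.+1%:Z = - (a + i.+1).+1%:Z by lia.
    have -> : - b.+1%:Z + i.+1%:Z = - (b - i.+1).+1%:Z by lia.
    by apply: IHb; lia.
  apply: Pn; apply: (@fil_amode n (-1) _ ie); apply: (@fil_annihilation n 0 _ iF) => //.
  by lia.
by apply: subspaceZ => //; apply: Pfe.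
Qed.

Lemma charge_neg s : charge s < 0 -> has (fun p => p.1 == iF) s.
Proof.
apply: contraTT => /hasPn H; rewrite -leNgt /charge big_seq.
apply: (big_ind (fun c => 0 <= c)) => //; first by move=> a b; apply: addr_ge0.
by move=> p /H; case: (ord3P p.1) => ->.
Qed.

Lemma charge_pos s : 0 < charge s -> has (fun p => p.1 == ie) s.
Proof.
apply: contraTT => /hasPn H; rewrite -leNgt /charge big_seq.
apply: (big_ind (fun c => c <= 0)) => //; first by move=> a b; lia.
by move=> p /H; case: (ord3P p.1) => ->.
Qed.

(** A leading h is peeled off directly. A leading e or f forces a factor of opposite charge further
    right; it is brought next to the leading one modulo shorter monomials, and [P_ef_mode]
    applies. *)
Lemma charge0_mono s : (forall n v, (n < size s)%N -> fil n 0 v -> P v) ->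
  charge s = 0 -> P (mono s).
Proof.
case: s => [|[a j] s] //= IH; rewrite charge_cons /=.
have front b s' : has (fun p => p.1 == b) s' ->
    exists i t, [/\ size s' = (size t).+1, charge s' = weight b + charge t &
      fil (size t) (charge s') (mono s' - mono ((b, i) :: t))].
  case/hasP=> -[b' i] /splitPr[s1 s2] /= /eqP->; exists i, (s1 ++ s2).
  have Ec : charge (s1 ++ (b, i) :: s2) = weight b + charge (s1 ++ s2).
    by rewrite !charge_cat charge_cons /= addrCA.
  by rewrite Ec !size_cat /= addnS; split=> //; apply: (mono_front s1 (b, i) s2).
case: (ord3P a) => -> /= cs.
- by apply: closedP => //; apply: (IH (size s)) => //; rewrite -cs add0r; apply: fil_mono.
- have [|i [t [st ct Ft]]] := front iF s.
    by apply: charge_neg; move: cs; rewrite /weight /=; lia.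
  have {}ct : charge t = 0 by move: cs; rewrite ct /weight /=; lia.
  apply: (subspace_congr subP (v := e (- j.+1%:Z) (f (- i.+1%:Z) (mono t)))).
    rewrite -(amodeB x VA); apply: (IH (size s)) => //; rewrite st -cs.
    exact: fil_creation Ft.
  apply: (P_ef_mode (n := size t)) => [v Fv||].
  - by apply: (IH (size s)) => //; rewrite st.
  - by rewrite -ct; apply: fil_mono.
  - by apply: (IH (size t)); [rewrite st ltnW|rewrite -ct; apply: fil_mono].
- have [|i [t [st ct Ft]]] := front ie s.
    by apply: charge_pos; move: cs; rewrite /weight /=; lia.
  have {}ct : charge t = 0 by move: cs; rewrite ct /weight /=; lia.
  apply: (subspace_congr subP (v := f (- j.+1%:Z) (e (- i.+1%:Z) (mono t)))).
    rewrite -(amodeB x VA); apply: (IH (size s)) => //; rewrite st -cs.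
    exact: fil_creation Ft.
  (* Putting e before f again changes the vector only by shorter monomials. *)
  apply: (subspace_congr subP (v := e (- i.+1%:Z) (f (- j.+1%:Z) (mono t)))).
    apply: (IH (size s)) => //; rewrite st -[0]/(weight iF + weight ie + 0) -ct.
    by apply: fil_commutator (fil_mono t).
  apply: (P_ef_mode (n := size t)) => [v Fv||].
  - by apply: (IH (size s)) => //; rewrite st.
  - by rewrite -ct; apply: fil_mono.
  - by apply: (IH (size t)); [rewrite st ltnW|rewrite -ct; apply: fil_mono].
Qed.

Lemma charge0_sub n v : fil n 0 v -> P v.
Proof.
elim/ltn_ind: n v => n IH; apply: linspan_min => // _ [s [sz cs ->]].
by apply: charge0_mono => // n' v' lt; apply: IH; apply: leq_trans lt sz.
Qed.

End ChargeZero.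
End Filtration.

(** * Obtaining all vectors e(-m-1)f(-1)1 from [omega] and [W^3] *)

Section Generators.
Variables (F : numFieldType) (V : lmodType F).
Variables (Y : V -> int -> V -> V) (vac : V) (x : 'I_3 -> V) (k : nat).
Hypothesis k_gt0 : (0 < k)%N.
Hypothesis VA : vertex_algebra Y vac.
Hypothesis AR : affine_relations Y x k%:R.

Notation h := (amode Y x ih).
Notation e := (amode Y x ie).
Notation f := (amode Y x iF).

Variable P : V -> Prop.
Hypothesis subP : subspace P.
Hypothesis closedP : forall u v n, P u -> P v -> P (Y u n v).
Hypothesis P_vac : P vac.
Hypothesis P_h : P (x ih).
Hypothesis P_omega : P (omega_vec Y vac x k%:R).
Hypothesis P_W3 : P (W3_vec Y vac x k%:R).

Notation u m := (e (- m.+1%:Z) (x iF)).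

Lemma amode_vac1 a : amode Y x a (-1) vac = x a.
Proof. exact: vac_state VA _. Qed.

Lemma P_h_mode n v : P v -> P (h n v).
Proof. exact: closedP. Qed.

Lemma binz_1 p : binz F p 1 = p%:~R.
Proof. by rewrite /binz big_ord1 subr0 divr1. Qed.

(** These are the coefficients of the product formula for u_1 = e(-2)f(-1)1; their positivity rules
    out cancellation in [P_u]. *)
Lemma binz_m2 i : (-1) ^+ i * binz F (-2) i = i.+1%:R.
Proof.
have -> : binz F (-2) i = (-1) ^+ i * i.+1%:R.
  have fi0 : (i`!%:R : F) != 0 by rewrite pnatr_eq0 -lt0n fact_gt0.
  apply: (mulIf fi0); rewrite /binz divfK// -mulrA -natrM -factS {fi0}.
  elim: i => [|i IH]; first by rewrite big_ord0 mul1r.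
  rewrite big_ord_recr /= IH exprS [(i.+2)`!]factS natrM.
  have -> : ((-2 - i%:Z)%:~R : F) = - i.+2%:R.
    by rewrite (_ : -2 - i%:Z = - i.+2%:Z) ?intrN//; lia.
  by ring.
by rewrite mulrA -expr2 sqrr_sign mul1r.
Qed.

(** The mode -2 applied to the vacuum is the translation operator, and the two terms are its Leibniz
    rule. *)
Lemma u_derivative m :
  Y (u m) (-2) vac = e (- m.+1%:Z) (f (-2) vac) + m.+1%:R *: u m.+1.
Proof.
have [N HN] := mode_product VA (x ie) (x iF) (- m.+1%:Z) (-2) vac.
have vac0 a (i : nat) : Y (x a) i vac = 0 by apply: (vac_annihil VA).
(* From index 2 on, the mode of f is nonnegative and kills the vacuum; [N.+2] exposes the first two
   terms. *)
rewrite [LHS](HN N.+2) ?leqW// !big_ord_recl big1 => [|i _]; last first.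
  rewrite /= /bump /= !add1n vac0 (mode0 VA) scaler0 subr0.
  have -> : (-2 + i.+2%:Z = i)%R by lia.
  by rewrite vac0 (mode0 VA) scaler0.
rewrite /= /bump /= !vac0 !(mode0 VA) !scaler0 !subr0 !addr0 (binz_0 F) binz_1.
rewrite mulr1 expr0 expr1 scale1r; congr (_ + _).
have -> : (-1 * (- m.+1%:Z)%:~R : F) = m.+1%:R by rewrite intrN mulrNN mul1r.
have -> : (- m.+1%:Z - (1 + 0)%N%:Z = - m.+2%:Z)%R by lia.
by rewrite -[Y (x iF) _ vac]/(f (-1) vac) amode_vac1.
Qed.

Lemma P_u0 : P (u 0).
Proof.
have c0 : (2 * k%:R * (k%:R + 2))^-1 != 0 :> F.
  by rewrite invr_eq0 -natrD -!natrM pnatr_eq0; lia.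
have := subspaceZ_inv subP c0 P_omega; rewrite !amode_vac1.
move/(subspace_addr subP) => H; apply: (@subspaceZ_inv _ _ _ subP (2 * k%:R)).
  by rewrite -natrM pnatr_eq0; lia.
apply: H; apply: subspaceB => //.
  by apply: subspaceN => //; apply: subspaceZ => //; apply: P_h_mode.
exact: P_h_mode.
Qed.

(** Modulo h-modes of known vectors, [W^3] yields the difference of e(-2)f(-1)1 and e(-1)f(-2)1,
    while the derivative of [u 0] yields their sum. *)
Lemma P_u1 : P (u 1).
Proof.
have k3 : (3 * k%:R ^+ 2 : F) != 0.
  by rewrite -natrX -natrM pnatr_eq0 muln_eq0 /= expn_eq0 andbT -lt0n.
have Pd : P (e (-2) (f (-1) vac) - e (-1) (f (-2) vac)).
  apply: (subspaceZ_inv subP k3).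
  have -> : (3 * k%:R ^+ 2) *: (e (-2) (f (-1) vac) - e (-1) (f (-2) vac)) =
      W3_vec Y vac x k%:R - (k%:R ^+ 2 *: h (-3) vac
        + (3 * k%:R) *: h (-2) (h (-1) vac) + 2 *: h (-1) (h (-1) (h (-1) vac))
        - (6 * k%:R) *: h (-1) (e (-1) (f (-1) vac))).
    by rewrite /W3_vec; module_eq F.
  rewrite !amode_vac1; apply: subspaceB => //.
  by repeat first [exact: P_h | exact: P_u0 | exact: P_vac | apply: P_h_mode
                  | apply: subspaceZ => // | apply: subspaceB => // | apply: subspaceD => //].
pose w := e (-1) (f (-2) vac).
have {}Pd : P (u 1 - w) by move: Pd; rewrite amode_vac1.
have Ps : P (w + u 1) by have := closedP (-2) P_u0 P_vac; rewrite u_derivative scale1r.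
apply: (@subspaceZ_inv _ _ _ subP 2); first by rewrite pnatr_eq0.
have := subspaceD subP Pd Ps; congr P; module_eq F.
Qed.

(* The total coefficient of u_{m+1} in (u_1)_1 u_m only has to be nonzero, so
   instead of its closed form each summand is shown to contribute a natural
   number multiple of u_{m+1}, the one of index 0 a positive multiple. *)
Lemma e_u_term m (i : nat) : (forall j, (j <= m)%N -> P (u j)) ->
  exists c : nat, P (e (-2 - i%:Z) (f (1 + i%:Z) (u m)) - c%:R *: u m.+1).
Proof.
move=> IH; have fv : f (1 + i%:Z) vac = 0 by apply: (amode_vac x VA); lia.
rewrite -amode_vac1 (f_e AR) (f_f AR) fv !(amode0 x VA) add0r.
have [lt|gt|->] := ltngtP i m.
(* Here f(1+i) meets e(-m-1) in a creation mode of h; moving that mode left past e gives twice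
   [u m.+1], up to an h-mode of [u i.+1]. *)
- exists 2%N; rewrite ifN ?scale0r ?addr0; last by lia.
  rewrite (amodeN x VA) (e_h AR) (_ : -2 - i%:Z + _ = - m.+2%:Z); last by lia.
  rewrite (_ : -2 - i%:Z = - i.+2%:Z); last by lia.
  rewrite opprB addrC addrA addNr sub0r.
  by apply: subspaceN => //; apply: P_h_mode; rewrite amode_vac1; apply: IH.
- exists 0%N; rewrite ifN ?scale0r ?addr0 ?subr0; last by lia.
  rewrite (h_f AR) !(amode_vac x VA); try lia.
  by rewrite (amode0 x VA) scaler0 subr0 oppr0 (amode0 x VA); apply: subspace0.
(* The 2 comes from h(0) acting on f(-1)1, and [m.+1 * k] from the central term. *)
exists (2 + m.+1 * k)%N.
rewrite (_ : 1 + m%:Z + _ = 0); last by lia.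
have hv : h 0 vac = 0 by apply: (amode_vac x VA).
rewrite eqxx (h_f AR) hv (amode0 x VA) !(amodeD x VA) (amodeN x VA).
rewrite !(amodeD x VA) (amodeN x VA) !(amodeZ x VA) (amode0 x VA) add0r.
rewrite (_ : -2 - m%:Z = - m.+2%:Z); last by lia.
rewrite (_ : (1 + m%:Z)%:~R = m.+1%:R :> F); last by rewrite -add1n.
rewrite -[f (0 + -1) vac]/(f (-1) vac) natrD natrM [X in P X](_ : _ = 0); first exact: subspace0.
by module_eq F.
Qed.

Lemma P_fe_ef (a b : nat) :
  P (f (- a.+1%:Z) (e (- b.+1%:Z) vac) - e (- b.+1%:Z) (f (- a.+1%:Z) vac)).
Proof.
rewrite (f_e AR); case: eqP => [|_]; first by lia.
rewrite scale0r addr0 addrC addKr.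
by apply: subspaceN => //; apply: P_h_mode.
Qed.

(** The derivative of [u m] shows that e(-m-1)f(-2)1 equals -(m+1) times [u m.+1] modulo [P];
    reordering f and e costs only h-modes of the vacuum. *)
Lemma f_u_term m (i : nat) : P (u m) ->
  exists c : nat, P (f (-1 - i%:Z) (e i (u m)) + c%:R *: u m.+1)
    /\ (i = 0%N -> (0 < c)%N).
Proof.
have P1 := P_fe_ef 0 m; have P2 := P_fe_ef 1 m; have P3 := P_fe_ef 0 m.+1.
move=> Pu; have := closedP (-2) Pu P_vac; rewrite u_derivative => Pd.
have ev : e i vac = 0 by apply: (amode_vac x VA).
rewrite -amode_vac1 (e_e AR) (e_f AR) ev (amode0 x VA) add0r.
rewrite amode_vac1 in P1.
case: i ev => [|[|i]] ev.
(* Modulo [P] the vector is 2f(-2)e(-m-1)1 - 2f(-1)e(-m-2)1, which contributes -2(m+1) - 2. *)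
- exists (2 * m.+2)%N; split=> //; case: eqP => [|_]; first by lia.
  rewrite subr0 add0r scale0r addr0.
  rewrite (e_h AR) (amodeB x VA) (amodeZ x VA) (f_h AR).
  rewrite (_ : - m.+1%:Z + -1 = - m.+2%:Z); last by lia.
  have := P_h_mode (-1) (subspace_congr subP P1 Pu).
  move/(subspaceD subP)/(_ (subspaceZ subP 2 (subspaceB subP (subspaceD subP P2 Pd) P3))).
  congr P; rewrite -!amode_vac1 -[(-1 + -1)%R]/(- 2%:Z) natrM -[m.+2%:R]natr1.
  by module_eq F.
(* Only the central term of e(1) with f(-1) survives, leaving [k] times f(-2)e(-m-1)1. *)
- exists (k * m.+1)%N; split=> //; case: eqP => [_|]; last by lia.
  rewrite (amode_vac x VA)// add0r !(amodeZ x VA) mul1r.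
  have := subspaceZ subP k%:R (subspaceD subP P2 Pd).
  rewrite -[(-1 - 1%:Z)%R]/(- 2%:Z) -amode_vac1 natrM.
  by congr P; module_eq F.
exists 0%N; split=> //; case: eqP => [|_]; first by lia.
rewrite (amode_vac x VA); last by lia.
by rewrite !scale0r !addr0 !(amode0 x VA); apply: subspace0.
Qed.

Lemma P_u m : P (u m).
Proof.
elim/ltn_ind: m => -[|[|m]] IH; [exact: P_u0|exact: P_u1|].
(* The mode 1 of the weight 3 vector [u 1] raises the weight by one, from [u m.+1] to [u m.+2]. *)
have Pu1 := closedP 1 P_u1 (IH m.+1 (ltnSn _)).
have [N HN] := mode_product VA (x ie) (x iF) (-2) 1 (u m.+1).
have IHe j : (j <= m.+1)%N -> P (u j) by apply: IH.
have term (i : nat) : exists c : nat, P (((-1) ^+ i * binz F (-2) i) *: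
    (Y (x ie) (-2 - i%:Z) (Y (x iF) (1 + i%:Z) (u m.+1))
     - sgnz F (-2) *: Y (x iF) (1 + -2 - i%:Z) (Y (x ie) i (u m.+1)))
    - c%:R *: u m.+2) /\ (i = 0%N -> (0 < c)%N).
  have [c Pc] := e_u_term i IHe.
  have [d [Pd d0]] := f_u_term i (IHe _ (leqnn _)).
  exists (i.+1 * (c + d))%N; split; last by move=> i0; have := d0 i0; nia.
  rewrite binz_m2 natrM natrD -scalerA -scalerBr scale1r; apply: subspaceZ => //.
  by have := subspaceB subP Pc Pd; congr P; module_eq F.
have sum M : exists c : nat, P (\sum_(i < M) ((-1) ^+ i * binz F (-2) i) *:
    (Y (x ie) (-2 - i%:Z) (Y (x iF) (1 + i%:Z) (u m.+1))
     - sgnz F (-2) *: Y (x iF) (1 + -2 - i%:Z) (Y (x ie) i%:Z (u m.+1)))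
    - c%:R *: u m.+2) /\ ((0 < M)%N -> (0 < c)%N).
  elim: M => [|M [c [Pc c0]]].
    by exists 0%N; split=> //; rewrite big_ord0 scale0r subr0; apply: subspace0.
  have [d [Pd d0]] := term M; exists (c + d)%N; split; last by case: M {Pc Pd} c0 d0; lia.
  by rewrite big_ord_recr natrD /=; have := subspaceD subP Pc Pd; congr P; module_eq F.
(* A nonempty range contains index 0, whose positive contribution makes [c] invertible. *)
have [c [Pc c0]] := sum N.+1; rewrite -HN// in Pc.
apply: (subspaceZ_inv subP (a := c%:R)); first by rewrite pnatr_eq0 -lt0n c0.
have := subspaceB subP Pu1 Pc.
by congr P; rewrite opprB addrC subrK.
Qed.

End Generators.

(** * Heisenberg descendants of a subalgebra of the commutant *)

Section Heisenberg.
Variables (F : numFieldType) (V : lmodType F).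
Variables (Y : V -> int -> V -> V) (vac : V) (x : 'I_3 -> V) (k : nat).
Hypothesis k_gt0 : (0 < k)%N.
Hypothesis VA : vertex_algebra Y vac.
Hypothesis AR : affine_relations Y x k%:R.

Notation h := (amode Y x ih).

Variable J : V -> Prop.
Hypothesis idealJ : ideal Y J.

Let subJ : subspace J. Proof. by case: idealJ. Qed.
Lemma ideal_mode u n v : J v -> J (Y u n v).
Proof. by case: idealJ => _ H Jv; case: (H u v n Jv). Qed.
Lemma ideal_state u n v : J u -> J (Y u n v).
Proof. by case: idealJ => _ H Ju; case: (H v u n Ju). Qed.

(** The commutator formula involves only modes of the vectors [h i u] with [i >= 0], which all lie
    in [J]. *)
Lemma K0_pre_mode u n v m : 0 <= m -> K0_pre Y x J u ->
  J (h m (Y u n v) - Y u n (h m v)).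
Proof.
move=> m0 Ku; apply: (subspace_commutator VA subJ) => i.
by apply: ideal_state; apply: Ku.
Qed.

Lemma K0_pre_subalgebra : subalgebra_mod Y vac J (K0_pre Y x J).
Proof.
split.
- split=> [m _|a u v Ku Kv m m0]; first by rewrite (amode0 x VA); apply: (subspace0 subJ).
  by rewrite (amode_linear x VA); apply: subspaceZD => //; [apply: Ku|apply: Kv].
- by move=> m m0; rewrite (amode_vac x VA)//; apply: subspace0.
- by move=> v Jv m m0; apply: ideal_mode.
move=> u v n Ku Kv m m0; apply: (subspace_congr subJ (K0_pre_mode n v m0 Ku)).
by apply: ideal_mode; apply: Kv.
Qed.

Variable T : V -> Prop.
Hypothesis subalgT : subalgebra_mod Y vac J T.
Hypothesis T_K0 : forall v, T v -> K0_pre Y x J v.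

Let subT : subspace T. Proof. by case: subalgT. Qed.
Let T_vac : T vac. Proof. by case: subalgT. Qed.
Let T_J v : J v -> T v. Proof. by case: subalgT => _ _ + _; apply. Qed.
Let T_mode u v n : T u -> T v -> T (Y u n v).
Proof. by case: subalgT => _ _ _; apply. Qed.

Definition heis_mono (s : seq nat) (t : V) : V :=
  foldr (fun j w => h (- j.+1%:Z) w) t s.

(** This is the space B of the outline. *)
Definition heis_span : V -> Prop :=
  linspan (fun v => exists s t, T t /\ v = heis_mono s t).

Lemma heis_span_subspace : subspace heis_span. Proof. exact: linspan_subspace. Qed.

Lemma heis_span_mono s t : T t -> heis_span (heis_mono s t).
Proof. by move=> Tt; apply: linspan_gen; exists s, t. Qed.

Lemma heis_span_T t : T t -> heis_span t.
Proof. exact: (@heis_span_mono [::]). Qed.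

Lemma heis_span_creation j v : heis_span v -> heis_span (h (- j.+1%:Z) v).
Proof.
apply: (linspan_min (P := fun v => heis_span (h (- j.+1%:Z) v))).
  by apply: subspace_preim heis_span_subspace; apply: (amode_linear x VA).
by move=> _ [s [t [Tt ->]]]; apply: (@heis_span_mono (j :: s)).
Qed.

Lemma heis_span_h n v : heis_span v -> heis_span (h n v).
Proof.
case: n => n; last by rewrite NegzE; apply: heis_span_creation.
apply: (linspan_min (P := fun v => heis_span (h n v))).
  by apply: subspace_preim heis_span_subspace; apply: (amode_linear x VA).
move=> _ [s [t [Tt ->]]]; elim: s => [|j s IH].
  by apply: heis_span_T; apply: T_J; apply: T_K0.
rewrite /= (h_h AR); apply: (subspaceD heis_span_subspace).
  exact: heis_span_creation.
by apply: (subspaceZ heis_span_subspace); apply: heis_span_mono.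
Qed.

Lemma heis_span_T_mode t n v : T t -> heis_span v -> heis_span (Y t n v).
Proof.
move=> Tt; apply: (linspan_min (P := fun v => heis_span (Y t n v))).
  by apply: subspace_preim heis_span_subspace; apply: (mode_linear VA).
move=> _ [s [t' [Tt' ->]]]; elim: s => [|j s IH] /=.
  by apply: heis_span_T; apply: T_mode.
apply: (subspace_congr heis_span_subspace (v := h (- j.+1%:Z) (Y t n (heis_mono s t')))).
  rewrite -opprB; apply: (subspaceN heis_span_subspace); apply: heis_span_T; apply: T_J.
  apply: (subspace_commutator VA subJ) => i.
  by apply: ideal_state; apply: T_K0.
exact: heis_span_creation.
Qed.

(** Induction on the number of h-factors of [u]: the product formula expresses the modes of h(-j-1)u
    through those of h and of [u]. *)
Lemma heis_span_mode u v n : heis_span u -> heis_span v -> heis_span (Y u n v).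
Proof.
move=> Bu; move: n v.
have sS : subspace (fun u => forall n v, heis_span v -> heis_span (Y u n v)).
  split=> [n v Bv|a u1 u2 B1 B2 n v Bv].
    have := @state_linear _ _ Y vac VA n v (-1) 0 0.
    rewrite scaler0 addr0 scaleN1r addNr => ->; exact: (subspace0 heis_span_subspace).
  have := @state_linear _ _ Y vac VA n v a u1 u2 => /= ->.
  by apply: (subspaceZD heis_span_subspace); [apply: B1|apply: B2].
apply: (linspan_min sS) Bu => _ [s [t [Tt ->]]].
elim: s => [|j s IH] n v Bv /=; first exact: heis_span_T_mode.
apply: (subspace_product VA heis_span_subspace) => i.
  by apply: heis_span_h; apply: IH.
by apply: IH; apply: heis_span_h.
Qed.

(** A truncation of the Heisenberg degree operator; [M] is later taken above all h-modes occurring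
    in a given vector. *)
Definition heis_op (M : nat) (v : V) : V :=
  \sum_(s < M) h (- s.+1%:Z) (h s.+1 v).

Lemma heis_op_linear M : linear (heis_op M).
Proof.
move=> a u v; rewrite /heis_op scaler_sumr -big_split; apply: eq_bigr => s _ /=.
by rewrite !(amode_linear x VA).
Qed.

Lemma heis_op_creation M r w : (r < M)%N -> heis_op M (h (- r.+1%:Z) w) =
  h (- r.+1%:Z) (heis_op M w) + (2 * k%:R * r.+1%:R) *: h (- r.+1%:Z) w.
Proof.
move=> rM; rewrite /heis_op.
have -> : h (- r.+1%:Z) (\sum_(s < M) h (- s.+1%:Z) (h s.+1 w))
    = \sum_(s < M) h (- r.+1%:Z) (h (- s.+1%:Z) (h s.+1 w)).
  exact: (big_morph _ (amodeD x VA _ _) (amode0 x VA _ _)).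
have swap (s : 'I_M) : h (- s.+1%:Z) (h s.+1 (h (- r.+1%:Z) w)) =
    h (- r.+1%:Z) (h (- s.+1%:Z) (h s.+1 w))
    + (if s == Ordinal rM then (2 * k%:R * r.+1%:R) *: h (- r.+1%:Z) w else 0).
  rewrite (h_h AR s.+1) (amodeD x VA) (amodeZ x VA) (h_h AR (- s.+1%:Z)).
  case: eqP => [|_]; first by lia.
  rewrite scale0r addr0; congr (_ + _).
  case: (eqVneq s (Ordinal rM)) => [->/=|ne].
    by rewrite subrr eqxx; module_eq F.
  case: eqP => [E|_]; last by rewrite scale0r.
  by case/eqP: ne; apply: val_inj => /=; lia.
by rewrite (eq_bigr _ (fun s _ => swap s)) big_split /= -big_mkcond big_pred1_eq.
Qed.

(** Positive h-modes send [t] into [J], and each creation factor of degree l adds 2kl to the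
    eigenvalue. *)
Lemma heis_op_mono M s t : T t -> all (fun j => j < M)%N s ->
  J (heis_op M (heis_mono s t)
     - (2 * k%:R * (\sum_(j <- s) j.+1)%:R) *: heis_mono s t).
Proof.
move=> Tt; elim: s => [|r s IH] /= => [_|/andP[rM /IH Js]].
  rewrite big_nil mulr0 scale0r subr0; apply: subspace_sum => // i.
  by apply: ideal_mode; apply: T_K0.
have := ideal_mode (x ih) (- r.+1%:Z) Js.
rewrite -[Y _ _ _]/(h _ _) (amodeB x VA) (amodeZ x VA) heis_op_creation// big_cons natrD.
by congr J; module_eq F.
Qed.

Lemma heis_span_split v : heis_span v -> exists M,
  eigen_split (heis_op M) J T v.
Proof.
(* Asking for all larger bounds lets the bounds of several summands be merged into their maximum. *)
move=> Bv; suff [M HM] : exists M, forall M', (M <= M')%N -> eigen_split (heis_op M') J T v.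
  by exists M; apply: HM.
have stabJ M u : J u -> J (heis_op M u).
  by move=> Ju; apply: subspace_sum => // i; do 2!apply: ideal_mode.
have sE M := eigen_split_subspace (@heis_op_linear M) subJ subT.
elim: Bv => [|a _ w [s [t [Tt ->]]] _ [M HM]].
  by exists 0%N => M _; apply: subspace0 (sE M).
exists (maxn M (\max_(j <- s) j.+1)) => M'; rewrite geq_max => /andP[leM les].
apply: (subspaceZD (sE M')); last exact: HM.
have lts : all (fun j => j < M')%N s.
  apply/allP => j js; apply: leq_trans les.
  by rewrite (big_rem j)//= leq_maxl.
(* The empty product goes to the part in [T]; a nonempty one has a nonzero eigenvalue, as [k] is
   positive. *)
case: s lts {les} => [|j s] lts.
  exists t, 0%N, 0; split; rewrite ?addr0//; apply: eigen_sum0; exact: subspace0.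
exists 0, 1%N, (heis_mono (j :: s) t + 0); split; first exact: subspace0.
  apply: eigen_sumS (heis_op_mono Tt lts) _; last by apply: eigen_sum0; apply: subspace0.
  by rewrite -!natrM pnatr_eq0 big_cons; lia.
by rewrite add0r addr0.
Qed.

(** Membership in K_0 puts the image of [v] under [heis_op] in [J], so only its component in [T]
    survives modulo [J]. *)
Lemma heis_span_K0 v : heis_span v -> K0_pre Y x J v -> T v.
Proof.
move=> /heis_span_split[M Sv] Kv.
have stabJ u : J u -> J (heis_op M u).
  by move=> Ju; apply: subspace_sum => // i; do 2!apply: ideal_mode.
have opK u : K0_pre Y x J u -> J (heis_op M u).
  by move=> Ku; apply: subspace_sum => // i; apply: ideal_mode; apply: Ku.
have [w Tw Jvw] := eigen_split_ker (@heis_op_linear M) subJ stabJ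
  (fun w Tw => opK w (T_K0 Tw)) Sv (opK _ Kv).
by apply: (subspace_congr subT) Tw; apply: T_J.
Qed.

End Heisenberg.

(** * Reduction to charge zero and generation of K_0 *)

Section Generation.
Variables (F : numFieldType) (V : lmodType F).
Variables (Y : V -> int -> V -> V) (vac : V) (x : 'I_3 -> V) (k : nat).
Hypothesis k_gt0 : (0 < k)%N.
Hypothesis VA : vertex_algebra Y vac.
Hypothesis AR : affine_relations Y x k%:R.
Hypothesis pbwV : pbw_basis Y vac x.
Variable J : V -> Prop.
Hypothesis idealJ : ideal Y J.

Notation h := (amode Y x ih).
Notation mono := (pbw_mono Y vac x).

Let subJ : subspace J. Proof. by case: idealJ. Qed.

Lemma h0_mono s : h 0 (mono s) = (2 * charge s)%:~R *: mono s.
Proof.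
elim: s => [|[a j] s IH] /=.
  by rewrite (amode_vac x VA)// /charge big_nil mulr0 scale0r.
rewrite charge_cons mulrDr intrD scalerDl.
have swap w : h 0 (amode Y x a (- j.+1%:Z) w) =
    amode Y x a (- j.+1%:Z) (h 0 w)
    + (2 * weight a)%:~R *: amode Y x a (- j.+1%:Z) w.
  case: (ord3P a) => ->; rewrite /weight [nat_of_ord _]/=.
  - rewrite (h_h AR); case: eqP => [|_]; first by lia.
    by module_eq F.
  - by rewrite (h_e AR) add0r; module_eq F.
  - by rewrite (h_f AR) add0r; module_eq F.
by rewrite swap IH (amodeZ x VA) addrC.
Qed.

(** In a PBW expansion of [v], monomials of nonzero charge are eigenvectors of [h 0] with nonzero
    eigenvalue, and [h 0] sends [v] into [J]; hence only the charge-zero part remains modulo [J]. *)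
Lemma K0_pre_sub P v : subspace P -> (forall u, J u -> P u) ->
  (forall n u, fil Y vac x n 0 u -> P u) -> K0_pre Y x J v -> P v.
Proof.
(* The second conjunct is the kernel condition that [eigen_split_ker] asks of the component that is
   kept. *)
move=> subP JP P0 Kv; pose G u := P u /\ J (h 0 u).
have h0_lin : linear (h 0) by exact: (amode_linear x VA).
have sG : subspace G.
  split=> [|a u w [Pu Ju] [Pw Jw]].
    by split; rewrite ?(amode0 x VA); apply: subspace0.
  by split; rewrite ?h0_lin; apply: subspaceZD.
have [w [Pw _] Jvw] : exists2 w, G w & J (v - w).
  have stabJ u : J u -> J (h 0 u) by exact: ideal_mode idealJ _ _ _.
  apply: (eigen_split_ker h0_lin subJ stabJ) => [u []//||]; last exact: Kv.
  have sE := eigen_split_subspace h0_lin subJ sG.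
  have [ss [c [_ ->]]] := pbwV.1 v; apply: (subspace_sum sE) => i; apply: (subspaceZ sE).
  set s := nth _ _ _; have [c0|c0] := eqVneq (charge s) 0.
    exists (mono s), 0%N, 0; rewrite addr0; split=> //; last by apply: eigen_sum0; apply: subspace0.
    split; first by apply: (P0 (size s)); rewrite -c0; apply: fil_mono.
    by rewrite h0_mono c0 mulr0 scale0r; apply: subspace0.
  exists 0, 1%N, (mono s + 0); split; rewrite ?add0r ?addr0//; first exact: subspace0.
  rewrite -[mono s]addr0; apply: (eigen_sumS (a := (2 * charge s)%:~R)).
  - by rewrite intr_eq0 mulf_neq0.
  - by rewrite h0_mono subrr; apply: subspace0.
  - by apply: eigen_sum0; apply: subspace0.
by apply: (subspace_congr subP) Pw; apply: JP.
Qed.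

(** A general list [S] covers both generating sets of the theorem. One inclusion holds because K_0
    is itself a subalgebra; the other passes through [heis_span]. *)
Lemma K0_pre_generated S v :
  omega_vec Y vac x k%:R \in S -> W3_vec Y vac x k%:R \in S ->
  (forall s, s \in S -> K0_pre Y x J s) ->
  K0_pre Y x J v <-> generated_mod Y vac J S v.
Proof.
move=> S_omega S_W3 SK; set T := generated_mod Y vac J S.
have TK u : T u -> K0_pre Y x J u.
  by apply=> //; apply: K0_pre_subalgebra VA _ idealJ.
have gen s : s \in S -> T s by move=> Ss U _; apply.
have subalgT : subalgebra_mod Y vac J T.
  split.
  - split=> [U [sU _ _ _] _|a u w Tu Tw U sU SU]; first exact: subspace0.
    by case: (sU) => sU' _ _ _; apply: subspaceZD => //; [apply: Tu|apply: Tw].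
  - by move=> U [].
  - by move=> u Ju U [_ _ + _] _; apply.
  by move=> u w n Tu Tw U sU SU; case: (sU) => _ _ _; apply; [apply: Tu|apply: Tw].
split=> [Kv|]; last exact: TK.
have sB := heis_span_subspace Y x T.
have B_T := @heis_span_T _ _ Y x T.
apply: (heis_span_K0 k_gt0 VA AR idealJ subalgT TK) => //.
have B_mode := heis_span_mode VA AR idealJ subalgT TK.
have [_ T_vac T_J _] := subalgT.
have B_h : heis_span Y x T (x ih).
  rewrite -(amode_vac1 x VA).
  by apply: (heis_span_h VA AR subalgT TK); apply: B_T.
apply: K0_pre_sub Kv => // [u Ju|n u]; first by apply: B_T; apply: T_J.
apply: (charge0_sub VA AR sB) => //; first exact: B_T.
apply: (P_u k_gt0 VA AR sB) => //; apply: B_T => //; exact: gen.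
Qed.

End Generation.

Theorem theorem4p1 (F : numClosedFieldType) (V : lmodType F)
  (Y : V -> int -> V -> V) (vac : V) (x : 'I_3 -> V) (k : nat) (J : V -> Prop) :
  (2 <= k)%N ->
  vertex_algebra Y vac ->
  affine_relations Y x k%:R ->
  pbw_basis Y vac x ->
  maximal_ideal Y vac J ->
  (forall v, K0_pre Y x J v <->
     generated_mod Y vac J [:: omega_vec Y vac x k%:R; W3_vec Y vac x k%:R] v) /\
  (forall w4 w5,
     vir_primary_N0 Y x (omega_vec Y vac x k%:R) 4 w4 ->
     vir_primary_N0 Y x (omega_vec Y vac x k%:R) 5 w5 ->
     forall v, K0_pre Y x J v <->
       generated_mod Y vac J
         [:: omega_vec Y vac x k%:R; W3_vec Y vac x k%:R; w4; w5] v).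
Proof.
move=> k2 VA AR pbwV [[idealJ _] _].
have N0_K0 u : N0 Y x u -> K0_pre Y x J u.
  by move=> Nu m m0; rewrite Nu//; case: idealJ => -[].
have K_omega := N0_K0 _ (h_omega VA AR).
have K_W3 := N0_K0 _ (h_W3 VA AR).
have gen := K0_pre_generated (ltnW k2) VA AR pbwV idealJ.
split=> [v|w4 w5 [Nw4 _ _ _] [Nw5 _ _ _] v];
  apply: gen; rewrite ?inE ?eqxx ?orbT// => s; rewrite !inE.
  by case/orP => /eqP->.
by case/or4P => /eqP-> //; apply: N0_K0.
Qed.
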